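(* Let $X$ be a continuous random variable with absolutely continuous distribution function $F$, density $f$, and reversed hazard rate $\lambda(t)=f(t)/F(t)$. Then for $s>1$ the past entropy generating function satisfies $$\bar B_s(F;t)=(\lambda(t))^{s-1}$$ (for all $t$ in the support) if and only if $X$ is uniformly distributed on $[a,b]$, i.e. $F(x)=\frac{x-a}{b-a}$ for $a\le x\le b$.
   Context: Let $\ell=\inf\{x:F(x)>0\}$. The past entropy generating function is $\bar B_s(F;t)=\int_{\ell}^t\left(\frac{f(x)}{F(t)}\right)^s dx$, $s\ge1$, for $t$ with $F(t)>0$ (for non-negative $X$ this coincides with $\int_0^t (f(x)/F(t))^s dx$).
   Formalization: The density f is taken to equal F' wherever F is differentiable (altering f at one point breaks the ''if'' part), and ''t in the support'' is read as 0<F(t)<1 (a constant density on two separated intervals breaks the ''only if'' part otherwise). *)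

(* Defs.v *)
From HB Require Import structures.
From mathcomp Require Import all_boot all_order all_algebra.
From mathcomp Require Import all_classical all_reals all_analysis.
Set Implicit Arguments. Unset Strict Implicit. Unset Printing Implicit Defensive.
Import Order.TTheory GRing.Theory Num.Theory.
Import numFieldNormedType.Exports.
Local Open Scope classical_set_scope.
Local Open Scope ring_scope.

Definition ell (R : realType) (F : R -> R) : \bar R :=
  ereal_inf [set x%:E | x in [set x | 0 < F x]].

Definition past_egf (R : realType) (f F : R -> R) (s t : R) : \bar R :=
  (\int[@lebesgue_measure R]_(x in [set x : R | (ell F <= x%:E)%E /\ (x <= t)%R])
     ((f x / F t) `^ s)%:E)%E.

Definition rev_hazard (R : realType) (f F : R -> R) (t : R) : R := f t / F t.

(* Main.v *)
(** Write I = {0 < F < 1} and G t = \int_ell^t f^s. The identity for the entropy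
    generating function says G = F f^(s-1) at every point of I. Since F and G
    are continuous, f = (G/F)^(1/(s-1)) is continuous on I, so there F' = f and
    G' = f^s hold pointwise, whence
    (G/F)' = (f^s F - G f) / F^2 = 0.
    Thus f^(s-1) = G/F is constant on I, so F is affine on I; being continuous
    and onto (0, 1), it is the uniform distribution function. *)

Require Import Defs.
From HB Require Import structures.
From mathcomp Require Import all_boot all_order all_algebra.
From mathcomp Require Import all_classical all_reals all_analysis.
From mathcomp Require Import measurable_realfun.
From mathcomp Require Import ring lra.
Import Order.TTheory GRing.Theory Num.Theory.
Import numFieldNormedType.Exports.
Local Open Scope classical_set_scope.
Local Open Scope ring_scope.

(** * Preliminaries from real analysis *)

(** Splitting off the fixed integral over []-oo, v]], with [v = x - 1], reduces the claim to
    continuity of an integral with finite base point. The bound [u] leaves room to the right of [x],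
    since integrability is assumed only up to [u]. *)
Lemma Rintegral_Nyc_continuous (R : realType) (h : R -> R) (x u : R) :
  x < u ->
  (@lebesgue_measure R).-integrable `]-oo, u] (EFin \o h) ->
  {for x, continuous (fun y => \int[@lebesgue_measure R]_(z in `]-oo, y]) h z)}.
Proof.
move=> xu hi; pose v := (x - 1 : R).
have vu : v < u by rewrite /v; lra.
have hvu : (@lebesgue_measure R).-integrable `[v, u] (EFin \o h).
  by apply: integrableS hi => //; apply: subset_itvr.
have /(continuous_within_itvP _ vu)[+ _ _] :=
  parameterized_integral_continuous (ltW vu) hvu.
have xvu : x \in `]v, u[ by rewrite in_itv/= xu andbT /v; lra.
move=> /(_ x xvu) cx.
pose c := \int[@lebesgue_measure R]_(z in `]-oo, v]) h z.
pose H y := \int[@lebesgue_measure R]_(z in `]-oo, y]) h z.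
suff E : \near x, parameterized_integral (@lebesgue_measure R) v x h + c = H x.
  suff: H y @[y --> x] --> H x by [].
  rewrite -(nbhs_singleton E).
  apply: cvg_trans (cvgD cx (cvg_cst c)).
  exact: near_eq_cvg.
near=> y.
have yvu : y \in `]v, u[ by near: y; exact: near_in_itvoo.
move: yvu; rewrite in_itv/= => /andP[vy yu].
have hy : (@lebesgue_measure R).-integrable `]-oo, y] (EFin \o h).
  by apply: integrableS hi => //; apply: subset_itvl; rewrite bnd_simp ltW.
have := @Rintegral_itvB R h -oo%O (BRight y) v hy.
move=> /(_ isT (ltW vy)) E.
rewrite /H /parameterized_integral -Rintegral_itv_obnd_cbnd -?E ?subrK//.
by apply: integrableS hy => //; apply: subset_itvr.
Unshelve. all: by end_near. Qed.

(* Nonnegativity near [t] matters when [h t = 0]: [powR] is 1 at negative bases,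
   hence not continuous at 0. *)
Lemma continuous_powR_comp (R : realType) (h : R -> R) (t p : R) : 0 < p ->
  (\near t, 0 <= h t) -> {for t, continuous h} ->
  {for t, continuous (fun x => h x `^ p)}.
Proof.
move=> p0 h0 ch; have := nbhs_singleton h0; rewrite le_eqVlt => /predU1P[ht|ht].
- suff: h x `^ p @[x --> t] --> h t `^ p by [].
  rewrite -ht powR0 ?gt_eqF//.
  apply/cvgrPdist_lt => e e0; near=> x.
  have hx0 : 0 <= h x by near: x.
  rewrite sub0r normrN ger0_norm ?powR_ge0//.
  have -> : e = (e `^ p^-1) `^ p by rewrite -powRrM mulVf ?gt_eqF// powRr1// ltW.
  apply: gt0_ltr_powR => //; rewrite ?nnegrE ?powR_ge0//.
  near: x; apply: (cvgr_lt _ ch); rewrite -ht; exact: powR_gt0.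
- apply: (@continuous_comp _ _ _ h (@powR R ^~ p)) => //.
  apply: differentiable_continuous; apply/derivable1_diffP.
  by apply: derivable_powR; rewrite in_itv/= andbT.
Unshelve. all: by end_near. Qed.

Lemma is_derive_cst_slope (R : realType) (h : R -> R) (k x y : R) : x <= y ->
  (forall z, x <= z <= y -> is_derive z (1 : R) h k) -> h y - h x = k * (y - x).
Proof.
move=> xy dh; have [| |c _ ->//] := @MVT_segment R h (fun=> k) x y xy.
- by move=> z; rewrite in_itv/= => /andP[xz zy]; apply: dh; rewrite !ltW.
- apply: derivable_within_continuous => z; rewrite in_itv/= => /dh dz.
  exact: ex_derive.
Qed.

(** * Distribution functions given by a density *)

Section density.
Context {R : realType} {f F : R -> R}.
Local Notation mu := (@lebesgue_measure R).
Hypothesis f_ge0 : forall x, 0 <= f x.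
Hypothesis f_meas : measurable_fun setT f.
Hypothesis f_tot : (\int[mu]_(x in setT) (f x)%:E = 1)%E.
Hypothesis F_cdf :
  forall x, (F x)%:E = (\int[mu]_(y in [set y : R | (y <= x)%R]) (f y)%:E)%E.

Let F_cdf_itv x : (F x)%:E = (\int[mu]_(y in `]-oo, x]) (f y)%:E)%E.
Proof. by rewrite set_itvNyc F_cdf. Qed.

Lemma density_integrable (A : set R) : measurable A ->
  mu.-integrable A (EFin \o f).
Proof.
move=> mA; apply: (@integrableS _ _ _ _ setT) => //.
apply/integrableP; split; first exact/measurable_EFinP.
under eq_integral do rewrite gee0_abs ?lee_fin//.
by rewrite f_tot ltry.
Qed.

Lemma cdf_Rintegral : F = fun x => \int[mu]_(y in `]-oo, x]) f y.
Proof. by apply/funext => x; rewrite /Rintegral -F_cdf_itv. Qed.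

Lemma cdf_continuous : continuous F.
Proof.
move=> x; rewrite cdf_Rintegral.
by apply: (@Rintegral_Nyc_continuous R f x (x + 1)); [lra|exact: density_integrable].
Qed.

Lemma cdf_nondecreasing : {homo F : x y / x <= y}.
Proof.
move=> x y xy; rewrite -lee_fin !F_cdf_itv; apply: ge0_subset_integral => //=.
- by apply/measurable_EFinP; exact: measurable_funTS.
- by move=> z _; rewrite lee_fin.
- by apply: subset_itvl; rewrite bnd_simp.
Qed.

(** Monotone convergence: the masses of an increasing exhaustion of the line tend to 1. It serves
    for both tails of the distribution. *)
Let sup_integral (A : (set R)^nat) (v : R) : nondecreasing_seq A ->
  (forall n, measurable (A n)) -> \bigcup_n A n = setT -> v < 1 ->
  exists n, (v%:E < \int[mu]_(x in A n) (f x)%:E)%E.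
Proof.
move=> ndA mA AT v1.
have := @ge0_nondecreasing_set_cvg_integral _ (measurableTypeR R) R A (EFin \o f) mu ndA mA.
rewrite AT f_tot => cvA.
have {}cvA : (\int[mu]_(x in A n) (f x)%:E)%E @[n --> \oo] --> 1%E.
  apply: cvA => [n|n x _]; rewrite ?lee_fin//.
  by apply/measurable_EFinP; exact: measurable_funTS.
have vA : \forall n \near \oo, (v%:E < \int[mu]_(x in A n) (f x)%:E)%E.
  by apply: (cvA (fun y => (v%:E < y)%E)); apply: open_ereal_gt'; rewrite lte_fin.
by near \oo => n; exists n; near: n.
Unshelve. all: by end_near. Qed.

(** Mass escapes at neither end of the line, so [F] passes both below and above [v]; the
    intermediate value theorem does the rest. *)
Lemma cdf_surj (v : R) : 0 < v < 1 -> exists x, F x = v.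
Proof.
move=> /andP[v0 v1].
have [n nv] : exists n, (v%:E < \int[mu]_(x in `]-oo, n%:R]) (f x)%:E)%E.
  apply: sup_integral => //.
  - by move=> m n mn; apply/subsetPset/subset_itvl; rewrite bnd_simp ler_nat.
  - rewrite -subTset => x _; near \oo => n; exists n => //=; rewrite in_itv/=.
    by near: n; exact: nbhs_infty_ger.
(* Mass more than [1 - v] to the right of [-m] leaves less than [v] to its left. *)
have [m mv] : exists m,
    ((1 - v)%:E < \int[mu]_(x in `](- m%:R)%R, +oo[) (f x)%:E)%E.
  apply: sup_integral => //; last lra.
  - by move=> m p mp; apply/subsetPset/subset_itvr; rewrite bnd_simp lerN2 ler_nat.
  - rewrite -subTset => x _; near \oo => p; exists p => //=.
    by rewrite in_itv/= andbT ltrNl; near: p; exact: nbhs_infty_gtr.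
have Fn : v < F n%:R by rewrite -lte_fin F_cdf_itv.
have Fm : F (- m%:R) < v.
  have : ((F (- m%:R))%:E + \int[mu]_(x in `](- m%:R)%R, +oo[) (f x)%:E = 1)%E.
    rewrite F_cdf_itv -ge0_integral_setU//=.
    - rewrite -f_tot; congr integral.
      by rewrite -set_itvNyy -(@itv_bndbnd_setU _ _ _ (BRight (- m%:R : R))).
    - by apply/measurable_EFinP; exact: measurable_funTS.
    - by move=> y _; rewrite lee_fin.
    - by apply/disj_setPS => y [/=]; rewrite !in_itv/= andbT ltNge => ->.
  move: mv; case: (\int[mu]_(x in _) _)%E => // r.
  by rewrite lte_fin -EFinD => + [] ; lra.
have mn : - m%:R <= n%:R :> R by rewrite lerNl (le_trans _ (ler0n _ _))// oppr_le0.
have [||x _ <-] := @IVT R F _ _ v mn; last by exists x.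
- by apply: continuous_subspaceT; exact: cdf_continuous.
- by rewrite ge_min le_max (ltW Fn) (ltW Fm) orbT.
Unshelve. all: by end_near. Qed.

End density.

(* Cutting [f^s] off below [ell F] turns the integral over [ell, t] into one over
   `]-oo, t], whether or not [ell F] is finite. *)
Definition past_power {R : realType} (f F : R -> R) (s : R) : R -> R :=
  (fun y => f y `^ s) \_ [set y | (ell F <= y%:E)%E].

(** * The generating function as an integral over a half-line *)

Section past_power.
Context {R : realType} (f F : R -> R) (s : R).
Local Notation mu := (@lebesgue_measure R).
Hypothesis f_ge0 : forall x, 0 <= f x.
Hypothesis f_meas : measurable_fun setT f.

Lemma past_power_ge0 y : 0 <= past_power f F s y.
Proof. by rewrite /past_power patchE; case: ifP => // _; exact: powR_ge0. Qed.

Lemma measurable_ell_le : measurable [set y : R | (ell F <= y%:E)%E].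
Proof.
apply: is_interval_measurable => x y /= ex _ z /andP[xz _].
by rewrite (le_trans ex)// lee_fin.
Qed.

Lemma measurable_past_power : measurable_fun setT (past_power f F s).
Proof.
apply/(measurable_restrictT _ measurable_ell_le).
by apply: measurable_funTS; apply: (measurableT_comp (measurable_powR s) f_meas).
Qed.

Lemma past_powerE y : 0 < F y -> past_power f F s y = f y `^ s.
Proof.
move=> Fy; rewrite /past_power patchE mem_set//=.
by apply: ereal_inf_lbound; exists y.
Qed.

(** The identity lives in the extended reals because the integral of [f^s] may still be infinite
    here; nonnegativity alone lets the constant factor out. *)
Lemma past_egf_past_power t : 0 < F t ->
  past_egf f F s t =
    ((F t `^ s)^-1%:E * \int[mu]_(y in `]-oo, t]) (past_power f F s y)%:E)%E.
Proof.
move=> Ft; rewrite /past_egf -ge0_integralZl//=; last 3 first.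
- by apply/measurable_EFinP/measurable_funTS; exact: measurable_past_power.
- by move=> y _; rewrite lee_fin past_power_ge0.
- by rewrite lee_fin invr_ge0 powR_ge0.
transitivity (\int[mu]_(x in `]-oo, t] `&` [set y | (ell F <= y%:E)%E])
    ((f x / F t) `^ s)%:E)%E.
  by congr integral; apply/seteqP; split=> x /=; rewrite in_itv/= => -[].
rewrite integral_mkcondr; apply: eq_integral => y _.
rewrite /past_power !patchE; case: ifPn => _; last by rewrite mule0.
rewrite -EFinM powRM ?invr_ge0 ?(ltW Ft)//; congr EFin.
by rewrite mulrC -powR_inv1 ?(ltW Ft)// powRAC powR_inv1 ?powR_ge0.
Qed.

End past_power.

(** * The identity forces a uniform distribution *)

Section egf_rigidity.
Context {R : realType} {f F : R -> R} {s : R}.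
Local Notation mu := (@lebesgue_measure R).
Hypothesis f_ge0 : forall x, 0 <= f x.
Hypothesis f_meas : measurable_fun setT f.
Hypothesis f_tot : (\int[mu]_(x in setT) (f x)%:E = 1)%E.
Hypothesis F_cdf :
  forall x, (F x)%:E = (\int[mu]_(y in [set y : R | (y <= x)%R]) (f y)%:E)%E.
Hypothesis s_gt1 : 1 < s.
Hypothesis egfE : forall t, 0 < F t < 1 ->
  past_egf f F s t = ((rev_hazard f F t) `^ (s - 1))%:E.

Let g := past_power f F s.
Let G t := \int[mu]_(y in `]-oo, t]) g y.
Let F_cont : continuous F := cdf_continuous f_ge0 f_meas f_tot F_cdf.

Let integral_g t : 0 < F t < 1 ->
  (\int[mu]_(y in `]-oo, t]) (g y)%:E = (F t * f t `^ (s - 1))%:E)%E.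
Proof.
move=> It; have /andP[Ft _] := It.
have := egfE _ It; rewrite past_egf_past_power//.
have Fs : 0 < F t `^ s by exact: powR_gt0.
(* Finiteness comes from the identity itself: a positive multiple of an infinite integral cannot
   equal the real right-hand side. *)
case: (\int[mu]_(_ in _) _)%E => [r| |]; rewrite -?EFinM.
- move=> [] /(congr1 ( *%R (F t `^ s))).
  rewrite mulrA divff ?gt_eqF// mul1r => ->; congr EFin.
  rewrite /rev_hazard powRM ?invr_ge0 ?(ltW Ft)//.
  rewrite -(powR_inv1 (ltW Ft)) powRAC powR_inv1 ?powR_ge0//.
  rewrite mulrCA [RHS]mulrC; congr (_ * _).
  rewrite -powRB; last by rewrite (gt_eqF Ft) implybT.
  by rewrite opprB addrC subrK powRr1 ?ltW.
- by rewrite gt0_muley ?lte_fin ?invr_gt0.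
- by rewrite gt0_muleNy ?lte_fin ?invr_gt0.
Qed.

Let integrable_g t : 0 < F t < 1 -> mu.-integrable `]-oo, t] (EFin \o g).
Proof.
move=> It; apply/integrableP; split.
  by apply/measurable_EFinP/measurable_funTS; exact: measurable_past_power.
under eq_integral do rewrite gee0_abs ?lee_fin ?past_power_ge0//.
by rewrite integral_g// ltry.
Qed.

Let GE t : 0 < F t < 1 -> G t = F t * f t `^ (s - 1).
Proof. by move=> It; rewrite /G /Rintegral integral_g. Qed.

Let near_interior t : 0 < F t < 1 -> \near t, 0 < F t < 1.
Proof.
move=> /andP[F0 F1]; near=> u; apply/andP; split; near: u.
- exact: (cvgr_gt _ (F_cont t)).
- exact: (cvgr_lt _ (F_cont t)).
Unshelve. all: by end_near. Qed.

(** Supplies the right endpoint up to which [g] is integrable, as required by continuity and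
    differentiability of [G] at [t]. *)
Let interior_right t : 0 < F t < 1 -> exists2 u, t < u & 0 < F u < 1.
Proof.
move=> It; near t^'+ => u; exists u; first by near: u; exact: nbhs_right_gt.
by near: u; apply: cvg_within; exact: near_interior.
Unshelve. all: by end_near. Qed.

(** Continuity of [f] is what makes the fundamental theorem of calculus hold at every interior point
    rather than almost everywhere. It is gained by solving the identity for [f], the exponent
    [s - 1] being invertible. *)
Let f_cont t : 0 < F t < 1 -> {for t, continuous f}.
Proof.
move=> It; have [u tu Iu] := interior_right _ It.
have s10 : 0 < s - 1 by rewrite subr_gt0.
have fE x : 0 < F x < 1 -> f x = (G x / F x) `^ (s - 1)^-1.
  move=> Ix; have /andP[Fx _] := Ix.
  rewrite GE// mulrAC divff ?gt_eqF// mul1r -powRrM divff ?gt_eqF//.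
  by rewrite powRr1.
suff: f x @[x --> t] --> f t by [].
rewrite (fE _ It).
apply: (@cvg_trans _ ((G x / F x) `^ (s - 1)^-1 @[x --> t])).
  apply: near_eq_cvg; near=> x; rewrite -fE//.
  by near: x; exact: near_interior.
apply: (@continuous_powR_comp R (fun x => G x / F x)); rewrite ?invr_gt0//.
  near=> x; have Ix : 0 < F x < 1 by near: x; exact: near_interior.
  have /andP[Fx _] := Ix.
  by rewrite GE// divr_ge0 ?mulr_ge0 ?powR_ge0 ?(ltW Fx).
have /andP[Ft _] := It.
apply: cvgM; first exact: (Rintegral_Nyc_continuous _ _ _ _ tu (integrable_g _ Iu)).
by apply: cvgV; [rewrite gt_eqF|exact: F_cont].
Unshelve. all: by end_near. Qed.

Let is_derive_F t : 0 < F t < 1 -> is_derive t (1 : R) F (f t).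
Proof.
move=> It; rewrite (cdf_Rintegral F_cdf).
have [dF FE] := @continuous_FTC1 R f -oo%O t (t + 1) ltac:(lra)
  (density_integrable f_ge0 f_meas f_tot _ (measurable_itv _)) (ltNyr _) (f_cont _ It).
by rewrite derive1E in FE; exact: DeriveDef dF FE.
Qed.

Let is_derive_G t : 0 < F t < 1 -> is_derive t (1 : R) G (f t `^ s).
Proof.
move=> It; have [u tu Iu] := interior_right _ It.
have /andP[Ft _] := It.
(* The cut-off at [ell F] is invisible near [t], where [F] stays positive. *)
have cg : {for t, continuous g}.
  suff: g x @[x --> t] --> g t by [].
  rewrite /g past_powerE//.
  apply: (@cvg_trans _ (f x `^ s @[x --> t])).
    apply: near_eq_cvg; near=> x; rewrite past_powerE//.
    by near: x; exact: (cvgr_gt _ (F_cont t)).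
  apply: continuous_powR_comp; first exact: lt_trans s_gt1.
  - by near=> x; exact: f_ge0.
  - exact: f_cont.
have [dG GE'] := @continuous_FTC1 R g -oo%O t u tu (integrable_g _ Iu) (ltNyr _) cg.
by rewrite derive1E /g past_powerE// in GE'; exact: DeriveDef dG GE'.
Unshelve. all: by end_near. Qed.

Let interior_between x y z : 0 < F x < 1 -> 0 < F y < 1 -> x <= z <= y ->
  0 < F z < 1.
Proof.
move=> /andP[Fx _] /andP[_ Fy] /andP[xz zy].
have ndF := cdf_nondecreasing f_ge0 f_meas F_cdf.
by rewrite (lt_le_trans Fx (ndF _ _ xz)) (le_lt_trans (ndF _ _ zy) Fy).
Qed.

Let density_cst_le x y : x <= y -> 0 < F x < 1 -> 0 < F y < 1 -> f x = f y.
Proof.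
move=> xy Ix Iy.
have s10 : 0 < s - 1 by rewrite subr_gt0.
apply: (@powR_injective R _ s10); rewrite ?nnegrE//.
have HE z : 0 < F z < 1 -> (G * (fun x => (F x)^-1)) z = f z `^ (s - 1).
  move=> Iz; have /andP[Fz _] := Iz.
  by transitivity (G z / F z) => //; rewrite GE// mulrAC divff ?gt_eqF// mul1r.
rewrite -!HE//; apply/esym/subr0_eq.
rewrite -[RHS](mul0r (y - x)); apply: is_derive_cst_slope => // z xzy.
have Iz := interior_between _ _ _ Ix Iy xzy; have /andP[Fz _] := Iz.
apply: is_derive_eq.
  apply: is_deriveM; first exact: is_derive_G.
  by apply: is_deriveV; [rewrite gt_eqF|exact: is_derive_F].
rewrite GE// /GRing.scale/=.
(* With this factorisation the two terms of the quotient rule cancel. It holds even when [f z = 0],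
   because the total exponent [s] is nonzero. *)
have -> : f z `^ s = f z `^ (s - 1) * f z.
  rewrite -[X in _ * X]powRr1// -powRD ?subrK//.
  by apply/implyP; rewrite gt_eqF//; lra.
field; lra.
Qed.

Lemma cdf_linear : exists2 k : R, 0 < k &
  exists c : R, forall x, 0 < F x < 1 -> F x = k * x + c.
Proof.
have surj := cdf_surj f_ge0 f_meas f_tot F_cdf.
(* [t0] is the base point of the affine formula; [t1], at a different height, excludes slope
   zero. *)
have [t0 Ft0] : exists t, F t = 1 / 2 by apply: surj; lra.
have [t1 Ft1] : exists t, F t = 1 / 3 by apply: surj; lra.
have It0 : 0 < F t0 < 1 by rewrite Ft0; lra.
have It1 : 0 < F t1 < 1 by rewrite Ft1; lra.
have fk x : 0 < F x < 1 -> f x = f t0.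
  move=> Ix; have [xt|/ltW tx] := leP x t0; first exact: density_cst_le.
  by rewrite (density_cst_le _ _ tx).
have lin x : 0 < F x < 1 -> F x - F t0 = f t0 * (x - t0).
  move=> Ix; have [xt|/ltW tx] := leP x t0.
    (* Changing signs orients the increment along the segment from [x] to [t0]. *)
    apply: oppr_inj; rewrite -mulrN !opprB.
    apply: is_derive_cst_slope => // z xzt.
    have Iz := interior_between _ _ _ Ix It0 xzt.
    by rewrite -(fk _ Iz); exact: is_derive_F.
  apply: is_derive_cst_slope => // z txz.
  have Iz := interior_between _ _ _ It0 Ix txz.
  by rewrite -(fk _ Iz); exact: is_derive_F.
exists (f t0); last first.
  by exists (F t0 - f t0 * t0) => x /lin; lra.
rewrite lt_def f_ge0 andbT; apply/eqP => f0.
by have := lin _ It1; rewrite f0 Ft0 Ft1; lra.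
Qed.

Lemma cdf_uniform : exists a b : R, a < b /\ forall x,
  F x = if x < a then 0 else if x <= b then (x - a) / (b - a) else 1.
Proof.
have ndF := cdf_nondecreasing f_ge0 f_meas F_cdf.
have [k k0 [c Fk]] := cdf_linear.
have F_ge0 x : 0 <= F x.
  by rewrite (cdf_Rintegral F_cdf); apply: Rintegral_ge0.
have F_le1 x : F x <= 1.
  rewrite -lee_fin F_cdf -f_tot -set_itvNyc; apply: ge0_subset_integral => //=.
  - exact/measurable_EFinP.
  - by move=> y _; rewrite lee_fin.
(* Here the condition is on the line instead of on [F]. By surjectivity some [y] has
   [F y = k * x + c]; the affine formula at [y] and [k != 0] give [y = x]. *)
have FE (x : R) : 0 < k * x + c < 1 -> F x = k * x + c.
  move=> /[dup] Ix /(cdf_surj f_ge0 f_meas f_tot F_cdf)[y Fy].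
  rewrite -Fy in Ix; have := Fk _ Ix; rewrite Fy => /addIr/(mulfI (lt0r_neq0 k0)).
  by move=> xy; rewrite {1}xy.
(* The endpoints are where the line [k * x + c] reaches heights 0 and 1. *)
exists (- c / k), ((1 - c) / k); split.
  by rewrite ltr_pM2r ?invr_gt0//; lra.
have F0 (x : R) : k * x + c <= 0 -> F x = 0.
  move=> xc; apply/eqP; rewrite eq_le F_ge0 andbT; apply/ler_addgt0Pr => e e0.
  rewrite add0r.
  (* The point where the line has height [v] lies to the right of [x], and there [F] equals [v], at
     most [e]. The cap 1/2 keeps [v] inside the range of [FE]. *)
  pose v := Num.min e (1 / 2); have v0 : 0 < v by rewrite lt_min e0; lra.
  have v1 : v <= 1 / 2 by rewrite ge_min lexx orbT.
  have ve : v <= e by rewrite ge_min lexx.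
  have Ev : k * ((v - c) / k) + c = v by field; lra.
  apply: le_trans ve; rewrite -[leRHS]Ev -FE ?Ev; last lra.
  by apply: ndF; rewrite ler_pdivlMr//; lra.
have F1 (x : R) : 1 <= k * x + c -> F x = 1.
  move=> xc; apply/eqP; rewrite eq_le F_le1/=; apply/ler_addgt0Pr => e e0.
  (* Mirror image: compare with the point at height [1 - v], to the left of [x]. *)
  pose v := Num.min e (1 / 2); have v0 : 0 < v by rewrite lt_min e0; lra.
  have v1 : v <= 1 / 2 by rewrite ge_min lexx orbT.
  have ve : v <= e by rewrite ge_min lexx.
  have Ev : k * ((1 - v - c) / k) + c = 1 - v by field; lra.
  rewrite -lerBlDr; apply: (@le_trans _ _ (1 - v)); first lra.
  rewrite -[leLHS]Ev -FE ?Ev; last lra.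
  by apply: ndF; rewrite ler_pdivrMr//; lra.
move=> x; have -> : (1 - c) / k - - c / k = k^-1 by field; lra.
have E : k * (x - - c / k) = k * x + c by field; lra.
case: ifPn => [xa|]; last rewrite -leNgt => ax.
  by apply: F0; move: xa; rewrite ltr_pdivlMr//; lra.
case: ifPn => [xb|]; last rewrite -ltNge => bx.
  rewrite invrK [RHS]mulrC E; move: ax xb.
  rewrite ler_pdivrMr// ler_pdivlMr// => ax xb.
  (* [FE] covers only the open interval; at the endpoints the values come from [F0] and [F1]. *)
  have [xc|xc] := leP (k * x + c) 0; first by rewrite F0//; lra.
  have [xc1|xc1] := leP 1 (k * x + c); first by rewrite F1//; lra.
  by rewrite FE// xc.
by apply: F1; move: bx; rewrite ltr_pdivrMr//; lra.
Qed.

End egf_rigidity.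

(** * The uniform distribution satisfies the identity *)

Section uniform.
Context {R : realType} {f F : R -> R} {s a b : R}.
Hypothesis f_meas : measurable_fun setT f.
Hypothesis f_deriv : forall t, derivable F t 1 -> f t = derive1 F t.
Hypothesis ab : a < b.
Hypothesis FE : forall x,
  F x = if x < a then 0 else if x <= b then (x - a) / (b - a) else 1.

Lemma uniform_cdf_in x : a < x < b -> F x = (x - a) / (b - a).
Proof. by move=> /andP[ax xb]; rewrite FE ltNge (ltW ax) (ltW xb). Qed.

Lemma uniform_cdf_gt0 x : (0 < F x) = (a < x).
Proof.
rewrite FE; have [xa|xa|->] := ltgtP x a; first by rewrite ltxx.
  by case: ifP => _; rewrite ?ltr01// divr_gt0 ?subr_gt0.
by rewrite ltW// subrr mul0r ltxx.
Qed.

Lemma uniform_cdf_interior x : 0 < F x < 1 -> a < x < b.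
Proof.
move=> /andP[+ F1]; rewrite uniform_cdf_gt0 => ax; rewrite ax/=.
move: F1; rewrite FE (le_gtF (ltW ax)); case: ifPn => [xb|]; last by rewrite ltxx.
by rewrite ltr_pdivrMr ?subr_gt0// mul1r ltrD2r.
Qed.

(** [F] determines a density only almost everywhere; [f_deriv] selects the version equal to the
    derivative wherever that exists. Near [x], [F] agrees with an affine function of slope
    [(b - a)^-1]. *)
Lemma uniform_density x : a < x < b -> f x = (b - a)^-1.
Proof.
move=> axb.
have nF : {near x, (fun y => (b - a)^-1 * y - a / (b - a)) =1 F}.
  near=> y; rewrite uniform_cdf_in; first by rewrite mulrBl mulrC.
  suff : y \in `]a, b[ by rewrite in_itv.
  by near: y; apply: near_in_itvoo; rewrite in_itv.
have dA : is_derive x (1 : R) (fun y => (b - a)^-1 * y - a / (b - a)) (b - a)^-1.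
  have := is_deriveB (is_deriveZ (b - a)^-1 (is_derive_id (x : R) (1 : R)))
    (is_derive_cst (a / (b - a)) x (1 : R)).
  by rewrite subr0 /GRing.scale/= mulr1.
have dF : is_derive x (1 : R) F (b - a)^-1 := near_eq_is_derive nF dA.
by rewrite f_deriv ?derive1E; [exact: derive_val|exact: ex_derive].
Unshelve. all: by end_near. Qed.

Lemma ell_uniform : ell F = a%:E.
Proof.
apply/eqP; rewrite eq_le; apply/andP; split.
- apply/lee_addgt0Pr => e e0; apply: ereal_inf_lbound; exists (a + e) => //=.
  by rewrite uniform_cdf_gt0 ltrDl.
- by apply: le_ereal_inf_tmp => _ [x /= + <-]; rewrite uniform_cdf_gt0 lee_fin => /ltW.
Qed.

(** On []a, t[] the ratio [f x / F t] is the constant [(t - a)^-1], so the integral is its [s]-th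
    power times the length [t - a]. *)
Lemma past_egf_uniform t : 0 < F t < 1 ->
  past_egf f F s t = ((rev_hazard f F t) `^ (s - 1))%:E.
Proof.
move=> /uniform_cdf_interior atb; have /andP[at_ tb] := atb.
have ta : 0 < t - a by rewrite subr_gt0.
have hE x : a < x < b -> f x / F t = (t - a)^-1.
  move=> axb; rewrite uniform_density// uniform_cdf_in// invfM invrK mulrCA.
  by rewrite mulVf ?mulr1// gt_eqF// subr_gt0.
rewrite /past_egf ell_uniform.
have -> : [set x : R | (a%:E <= x%:E)%E /\ x <= t] = `[a, t]%classic.
  by apply/seteqP; split=> x /=; rewrite in_itv/= lee_fin => /andP.
(* The value of [f] at the corner [a] is unknown, so the integrands are compared on the open
   interval. *)
rewrite (@eq_integral_itv_bounded R a t (fun=> (t - a)^-1 `^ s)).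
- rewrite integral_cst//= lebesgue_measure_itv/= lte_fin at_ -EFinB -EFinM.
  rewrite /rev_hazard hE//; congr EFin.
  rewrite powRB; last by rewrite invr_eq0 (gt_eqF ta) implybT.
  by rewrite powRr1 ?invrK// invr_ge0 ltW.
- apply: measurable_funTS; apply: (measurableT_comp (measurable_powR s)).
  by apply: measurable_funM => //; exact: measurable_cst.
- exact: measurable_cst.
- by move=> x; rewrite in_itv/= => /andP[ax xt]; rewrite hE// ax (lt_trans xt).
Qed.

End uniform.

Theorem theorem3p2 (R : realType) (f F : R -> R) (s : R)
  (f_ge0 : forall x, 0 <= f x)
  (f_meas : measurable_fun setT f)
  (f_tot : (\int[@lebesgue_measure R]_(x in setT) (f x)%:E = 1)%E)
  (F_cdf : forall x, (F x)%:E = (\int[@lebesgue_measure R]_(y in [set y : R | (y <= x)%R]) (f y)%:E)%E)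
  (f_deriv : forall t, derivable F t 1 -> f t = derive1 F t)
  (s_gt1 : 1 < s) :
  (forall t, 0 < F t < 1 -> past_egf f F s t = ((rev_hazard f F t) `^ (s - 1))%:E)
  <->
  (exists a b : R, a < b /\
     forall x, F x = (if x < a then 0 else if x <= b then (x - a) / (b - a) else 1)).
Proof.
split=> [egfE|[a [b [ab FE]]] t]; first exact: cdf_uniform egfE.
exact: (past_egf_uniform f_meas f_deriv ab FE).
Qed.
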